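(* Let $\mathcal H=(\mathcal H_1,\dots,\mathcal H_m)(\mathcal Z,\mathcal Y)$ be a vector of multisort species such that the iteration $\mathcal Y^{[0]}=\mathbf 0$, $\mathcal Y^{[n+1]}=\mathcal H(\mathcal Z,\mathcal Y^{[n]})$ is well defined for $n=0,\dots,m$. Then the system $\mathcal Y=\mathcal H(\mathcal Z,\mathcal Y)$ is well founded if and only if the leading terms of $\mathcal Y^{[m]}$ and $\mathcal Y^{[m+1]}$ are equal (up to isomorphism). In this situation, the combinatorial solution $\mathcal S$ of the system satisfies $\mathrm{LT}(\mathcal S)=\mathrm{LT}(\mathcal Y^{[m]})$.
   Context: All objects are (multisort) combinatorial species in the sense of Joyal, with atom sorts $\mathcal Z=(\mathcal Z_1,\mathcal Z_2,\dots)$ and unknown sorts $\mathcal Y=(\mathcal Y_1,\dots,\mathcal Y_m)$; $\mathbf 0$ is the empty species. For a vector of species $\mathcal G$, the composition $\mathcal H(\mathcal Z,\mathcal G)$ is well defined when, for each $i$, either $\mathcal H$ is polynomial in $\mathcal Y_i$ or $\mathcal G_i$ has no structure of size $0$ (equivalently, for each size only finitely many structures are produced). The system $\mathcal Y=\mathcal H(\mathcal Z,\mathcal Y)$ is well founded when the iteration above is well defined for all $n$ and converges: there is a vector of species $\mathcal S$ such that for every $p$, $\mathcal Y^{[n]}$ and $\mathcal S$ agree up to isomorphism on all structures of size at most $p$ (contact of order $p$) for all large enough $n$; $\mathcal S$ is the combinatorial solution. The valuation of a species is the size of its smallest structure (infinite for $\mathbf 0$); its leading term $\mathrm{LT}$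 is the species restricted to structures of size equal to its valuation ($\mathrm{LT}(\mathbf 0)=\mathbf 0$); for vectors, $\mathrm{LT}$ is taken coordinatewise. *)

(* Defs.v *)
From HB Require Import structures.
From mathcomp Require Import all_boot.
From mathcomp Require Import boolp classical_sets cardinality.

Set Implicit Arguments.
Unset Strict Implicit.
Unset Printing Implicit Defensive.

Local Open Scope quotient_scope.

Record bij (A B : Type) := Bij {
  bij_fun :> A -> B;
  bij_inv : B -> A;
  bij_funK : cancel bij_fun bij_inv;
  bij_invK : cancel bij_inv bij_fun }.

Lemma bij_ext A B (f g : bij A B) : f =1 g -> f = g.
Proof.
case: f g => [f f' fK f'K] [g g' gK g'K] /= /funext efg.
rewrite -{}efg in gK g'K *.
have e : f' = g' by apply: funext => b; rewrite -{1}(g'K b) fK.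
case: _ / e in gK g'K *.
by congr Bij; apply: Prop_irrelevance.
Qed.

Lemma bij_bijective A B (f : bij A B) : bijective f.
Proof. exact: Bijective (@bij_funK _ _ f) (@bij_invK _ _ f). Qed.

Definition bij_id A : bij A A := @Bij A A id id (fun=> erefl) (fun=> erefl).

Definition bij_comp A B C (g : bij B C) (f : bij A B) : bij A C :=
  @Bij A C (g \o f) (bij_inv f \o bij_inv g)
    (can_comp (@bij_funK _ _ g) (@bij_funK _ _ f))
    (can_comp (@bij_invK _ _ f) (@bij_invK _ _ g)).

Definition bij_sym A B (f : bij A B) : bij B A :=
  Bij (@bij_invK _ _ f) (@bij_funK _ _ f).

(* Finite multisort sets (a finite set of atoms, each with a sort in K) and   *)
(* their sort-preserving bijections.                                          *)
Record sset (K : Type) := SSet {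
  atoms :> finType;
  sort_of : atoms -> K }.

Arguments sort_of {K s}.

Record sbij (K : Type) (U V : sset K) := SBij {
  sbij_bij :> bij U V;
  sbij_sort : forall u, sort_of (sbij_bij u) = sort_of u }.

Lemma sbij_ext K (U V : sset K) (f g : sbij U V) : f =1 g -> f = g.
Proof.
case: f g => [f sf] [g sg] /= /bij_ext efg.
case: _ / efg in sg *; congr SBij; exact: Prop_irrelevance.
Qed.

Definition sbij_id K (U : sset K) : sbij U U :=
  @SBij K U U (bij_id U) (fun=> erefl).

Definition sbij_comp K (U V W : sset K) (g : sbij V W) (f : sbij U V) :
    sbij U W :=
  @SBij K U W (bij_comp g f)
    (fun u => etrans (sbij_sort g (f u)) (sbij_sort f u)).

(* Functors from multisort sets to arbitrary sets; a species is such a        *)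
(* functor with finite values (predicate is_species). Dropping finiteness     *)
(* makes substitution total: it is well defined as an operation on species    *)
(* exactly when its result satisfies is_species.                              *)
Record prespecies (K : Type) := Prespecies {
  structures :> sset K -> Type;
  transport : forall U V, sbij U V -> structures U -> structures V;
  transport_id : forall U (x : structures U), transport (sbij_id U) x = x;
  transport_comp : forall U V W (g : sbij V W) (f : sbij U V) x,
    transport (sbij_comp g f) x = transport g (transport f x) }.

Arguments transport {K} p {U V}.

Definition is_species (K : Type) (F : prespecies K) : Prop :=
  forall U : sset K, finite_set [set: F U].

Definition species_iso (K : Type) (F G : prespecies K) : Prop :=
  exists phi : forall U : sset K, F U -> G U,
    (forall U, bijective (phi U)) /\
    (forall U V (f : sbij U V) (x : F U),
       phi V (transport F f x) = transport G f (phi U x)).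

Definition empty_species (K : Type) : prespecies K :=
  @Prespecies K (fun=> void) (fun _ _ _ x => x)
    (fun _ _ => erefl) (fun _ _ _ _ _ _ => erefl).

Section Singleton.
Variables (K : Type) (k : K).

Definition is_singleton (U : sset K) : Prop :=
  #|U| = 1 /\ forall u : U, sort_of u = k.

Lemma is_singleton_sbij (U V : sset K) :
  sbij U V -> is_singleton U -> is_singleton V.
Proof.
move=> f [U1 Uk]; split; first by rewrite -(bij_eq_card (bij_bijective f)).
by move=> v; rewrite -(bij_invK f v) sbij_sort.
Qed.

(* The species Z_k: one structure on each one-atom set of sort k, none on     *)
(* any other multisort set.                                                   *)
Definition singleton_species : prespecies K :=
  @Prespecies K is_singleton is_singleton_sbij
    (fun _ _ => Prop_irrelevance _ _) (fun _ _ _ _ _ _ => Prop_irrelevance _ _).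

End Singleton.

Section Restriction.
Variables (K : Type) (P : pred nat) (F : prespecies K).

Definition restrict_structures (U : sset K) : Type := {x : F U | P #|U|}.

Lemma restrict_card (U V : sset K) (f : sbij U V) : P #|U| -> P #|V|.
Proof. by rewrite (bij_eq_card (bij_bijective f)). Qed.

Definition restrict_transport (U V : sset K) (f : sbij U V)
    (x : restrict_structures U) : restrict_structures V :=
  exist _ (transport F f (sval x)) (restrict_card f (svalP x)).

Lemma restrict_transport_id U x : restrict_transport (sbij_id U) x = x.
Proof. by case: x => x px; apply: eq_exist; rewrite /= transport_id. Qed.

Lemma restrict_transport_comp U V W (g : sbij V W) (f : sbij U V) x :
  restrict_transport (sbij_comp g f) x
  = restrict_transport g (restrict_transport f x).
Proof. by apply: eq_exist; rewrite /= transport_comp. Qed.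

Definition restrict : prespecies K :=
  Prespecies restrict_transport_id restrict_transport_comp.

End Restriction.

Definition has_structure_of_size (K : Type) (F : prespecies K) (n : nat) :
    Prop :=
  exists U : sset K, #|U| = n /\ inhabited (F U).

(* None stands for infinity. *)
Definition valuation (K : Type) (F : prespecies K) : option nat :=
  if pselect (exists n, `[< has_structure_of_size F n >]) is left ex
  then Some (ex_minn ex) else None.

Definition leading_term (K : Type) (F : prespecies K) : prespecies K :=
  restrict (fun n => valuation F == Some n) F.

Definition contact (K : Type) (p : nat) (F G : prespecies K) : Prop :=
  species_iso (restrict (fun n => n <= p) F) (restrict (fun n => n <= p) G).

Definition fibre (K : Type) (U : sset K) (n : nat) (h : U -> 'I_n) (j : 'I_n) :
    sset K :=
  @SSet K {u : U | h u == j} (fun u => sort_of (val u)).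

Section FibreBij.
Variables (K : Type) (U V : sset K) (f : sbij U V) (n : nat).
Variables (h : U -> 'I_n) (h' : V -> 'I_n) (j j' : 'I_n).
Hypothesis hh' : forall u, (h' (f u) == j') = (h u == j).

Lemma fibre_fun_subproof (u : fibre h j) : h' (f (val u)) == j'.
Proof. by rewrite hh' (valP u). Qed.

Lemma fibre_inv_subproof (v : fibre h' j') : h (bij_inv f (val v)) == j.
Proof. by rewrite -hh' bij_invK (valP v). Qed.

Definition fibre_fun (u : fibre h j) : fibre h' j' :=
  exist _ (f (val u)) (fibre_fun_subproof u).

Definition fibre_inv (v : fibre h' j') : fibre h j :=
  exist _ (bij_inv f (val v)) (fibre_inv_subproof v).

Lemma fibre_funK : cancel fibre_fun fibre_inv.
Proof. by move=> u; apply: val_inj; rewrite /= bij_funK. Qed.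

Lemma fibre_invK : cancel fibre_inv fibre_fun.
Proof. by move=> u; apply: val_inj; rewrite /= bij_invK. Qed.

Definition fibre_bij : sbij (fibre h j) (fibre h' j') :=
  @SBij K (fibre h j) (fibre h' j') (Bij fibre_funK fibre_invK)
    (fun u => sbij_sort f (val u)).

End FibreBij.

(* Substitution F(G_l : l in L). A structure on U consists of finitely many   *)
(* blocks 0, ..., n-1 with sorts in L, an F-structure on the set of blocks, a *)
(* map h sending each atom of U to its block, and for each block j of sort l  *)
(* a G_l-structure on the set of atoms in block j. Blocks are anonymous, so   *)
(* these data are taken modulo renumbering of the blocks. When no G_l has a   *)
(* structure of size 0, h is onto and this is the usual substitution, by an   *)
(* F-structure on the classes of a partition of U; otherwise empty blocks are *)
(* allowed and, e.g., the species of 2-element sets with 1 + Z substituted    *)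
(* in it has one structure of size 0.                                         *)
Section Substitution.
Variables (K L : Type) (F : prespecies L) (G : L -> prespecies K).

Record assembly (U : sset K) := Assembly {
  nblocks : nat;
  block_sort : 'I_nblocks -> L;
  outer : F (SSet block_sort);
  block_of : U -> 'I_nblocks;
  inner : forall j, G (block_sort j) (fibre block_of j) }.

Lemma assembly_eq (U : sset K) n s h o o' i i' :
  o = o' -> (forall j, i j = i' j) ->
  @Assembly U n s o h i = @Assembly U n s o' h i'.
Proof.
move=> <- e; suff -> : i = i' by [].
exact: functional_extensionality_dep.
Qed.

Definition renumber_outer n (s : 'I_n -> L) (t : bij 'I_n 'I_n) :
    sbij (SSet s) (SSet (s \o bij_inv t)) :=
  @SBij L (SSet s) (SSet (s \o bij_inv t)) t
    (fun i => congr1 s (bij_funK t i)).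

Lemma renumber_inner_subproof (U : sset K) n (h : U -> 'I_n)
    (t : bij 'I_n 'I_n) (j : 'I_n) (u : U) :
  (t (h (sbij_id U u)) == j) = (h u == bij_inv t j).
Proof. by rewrite (can2_eq (bij_funK t) (bij_invK t)). Qed.

Definition renumber (U : sset K) (x : assembly U)
    (t : bij 'I_(nblocks x) 'I_(nblocks x)) : assembly U :=
  @Assembly U (nblocks x) (@block_sort _ x \o bij_inv t)
    (transport F (renumber_outer (@block_sort _ x) t) (outer x))
    (t \o @block_of _ x)
    (fun j => transport (G (block_sort (bij_inv t j)))
       (fibre_bij (renumber_inner_subproof (@block_of _ x) t j))
       (inner (bij_inv t j))).

Definition same_assembly (U : sset K) : rel {classic assembly U} :=
  fun x y => `[< exists t, y = renumber (x := x) t >].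

Lemma renumber_id U (x : assembly U) : renumber (bij_id 'I_(nblocks x)) = x.
Proof.
case: x => n s o h i; rewrite /renumber /=; apply: assembly_eq => [|j].
  rewrite -[RHS]transport_id; congr (transport F _ _); exact: sbij_ext.
rewrite -[RHS]transport_id; congr (transport _ _ _).
by apply: sbij_ext => u; apply: val_inj.
Qed.

Lemma renumber_comp U (x : assembly U) (t : bij 'I_(nblocks x) 'I_(nblocks x))
    (t' : bij 'I_(nblocks x) 'I_(nblocks x)) :
  renumber (x := renumber t) t' = renumber (bij_comp t' t).
Proof.
case: x t t' => n s o h i t t'; rewrite /renumber /=.
apply: assembly_eq => [|j].
  rewrite -transport_comp; congr (transport F _ _); exact: sbij_ext.
rewrite -transport_comp; congr (transport _ _ _).
by apply: sbij_ext => u; apply: val_inj.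
Qed.

Lemma same_assembly_refl U : reflexive (@same_assembly U).
Proof.
by move=> x; apply/asboolP; exists (bij_id _); rewrite renumber_id.
Qed.

Lemma same_assembly_sym U : symmetric (@same_assembly U).
Proof.
have sub x y : @same_assembly U x y -> @same_assembly U y x.
  move=> /asboolP[t ->]; apply/asboolP; exists (bij_sym t).
  rewrite renumber_comp -[LHS]renumber_id; congr renumber.
  by apply: bij_ext => i /=; rewrite bij_funK.
by move=> x y; apply/idP/idP; apply: sub.
Qed.

Lemma same_assembly_trans U : transitive (@same_assembly U).
Proof.
move=> y x z /asboolP[t ->] /asboolP[t' ->]; apply/asboolP.
by exists (bij_comp t' t); rewrite renumber_comp.
Qed.

Canonical same_assembly_equiv U :=
  EquivRel (@same_assembly U) (@same_assembly_refl U) (@same_assembly_sym U)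
    (@same_assembly_trans U).

Local Notation subst_structures U := {eq_quot (@same_assembly_equiv U)}.

Lemma assembly_transport_subproof (U V : sset K) (f : sbij U V) n
    (h : U -> 'I_n) (j : 'I_n) (u : U) :
  (h (bij_inv f (f u)) == j) = (h u == j).
Proof. by rewrite bij_funK. Qed.

Definition assembly_transport (U V : sset K) (f : sbij U V) (x : assembly U) :
    assembly V :=
  @Assembly V (nblocks x) (@block_sort _ x) (outer x)
    (@block_of _ x \o bij_inv f)
    (fun j => transport (G (block_sort j))
       (fibre_bij (assembly_transport_subproof f (@block_of _ x) j))
       (inner j)).

Definition subst_transport (U V : sset K) (f : sbij U V)
    (c : subst_structures U) : subst_structures V :=
  \pi_(subst_structures V) (assembly_transport f (repr c)).

Lemma assembly_transport_renumber U V (f : sbij U V) (x : assembly U)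
    (t : bij 'I_(nblocks x) 'I_(nblocks x)) :
  assembly_transport f (renumber t)
  = renumber (x := assembly_transport f x) t.
Proof.
case: x t => n s o h i t; rewrite /renumber /assembly_transport /=.
apply: assembly_eq => // j; rewrite -!transport_comp; congr (transport _ _ _).
by apply: sbij_ext => u; apply: val_inj.
Qed.

Lemma subst_transport_pi U V (f : sbij U V) (x : assembly U) :
  subst_transport f (\pi_(subst_structures U) x)
  = \pi_(subst_structures V) (assembly_transport f x).
Proof.
apply/eqmodP/asboolP.
have /eqmodP/asboolP[t e] : repr (\pi_(subst_structures U) x) = x
    %[mod subst_structures U] by rewrite reprK.
by exists t; rewrite {1}e assembly_transport_renumber.
Qed.

Lemma subst_transport_id U (c : subst_structures U) :
  subst_transport (sbij_id U) c = c.
Proof.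
rewrite -[c]reprK subst_transport_pi; congr \pi.
case: (repr c) => n s o h i; rewrite /assembly_transport /=.
apply: assembly_eq => // j.
rewrite -[RHS]transport_id; congr (transport _ _ _).
by apply: sbij_ext => u; apply: val_inj.
Qed.

Lemma subst_transport_comp U V W (g : sbij V W) (f : sbij U V) c :
  subst_transport (sbij_comp g f) c = subst_transport g (subst_transport f c).
Proof.
rewrite -[c]reprK (subst_transport_pi (sbij_comp g f)) (subst_transport_pi f).
rewrite (subst_transport_pi g); congr \pi.
case: (repr c) => n s o h i; rewrite /assembly_transport /=.
apply: assembly_eq => // j.
rewrite -transport_comp; congr (transport _ _ _).
by apply: sbij_ext => u; apply: val_inj.
Qed.

Definition subst : prespecies K :=
  @Prespecies K (fun U => subst_structures U) subst_transport
    subst_transport_id subst_transport_comp.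

End Substitution.

Section Systems.
Variables (K : Type) (m : nat).

(* H(Z, G): the sorts of H are K (atom sorts) and 'I_m (unknown sorts).       *)
Definition subst_unknowns (H : prespecies (K + 'I_m)%type)
    (G : 'I_m -> prespecies K) : prespecies K :=
  subst H (fun l => match l with
                    | inl k => singleton_species k
                    | inr i => G i
                    end).

(* H(Z, G) has finitely many structures on every finite multisort set (with   *)
(* finitely many atom sorts: finitely many structures of each size). This is  *)
(* guaranteed when, for each i, H has bounded degree in Y_i or G_i has no     *)
(* structure of size 0, but it also covers, e.g., Seq(Z_1 Y_1) with           *)
(* G_1 = 1 + Z_1.                                                             *)
Definition subst_well_defined (H : 'I_m -> prespecies (K + 'I_m)%type)
    (G : 'I_m -> prespecies K) : Prop :=
  forall i, is_species (subst_unknowns (H i) G).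

Definition iterate (H : 'I_m -> prespecies (K + 'I_m)%type) (n : nat) :
    'I_m -> prespecies K :=
  iter n (fun Y i => subst_unknowns (H i) Y) (fun=> empty_species K).

Definition combinatorial_solution (H : 'I_m -> prespecies (K + 'I_m)%type)
    (S : 'I_m -> prespecies K) : Prop :=
  (forall i, is_species (S i)) /\
  (forall p, exists N, forall n, N <= n ->
     forall i, contact p (iterate H n i) (S i)).

Definition well_founded_system (H : 'I_m -> prespecies (K + 'I_m)%type) :
    Prop :=
  (forall n, subst_well_defined H (iterate H n)) /\
  (exists S, combinatorial_solution H S).

End Systems.

(* Main.v *)
Require Import Defs.
From mathcomp Require Import all_boot.
From mathcomp Require Import boolp classical_sets cardinality.
From mathcomp Require Import zify.

(* The iterates embed in one another, Y^[n] in Y^[n+1], and the structures of *)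
(* Y^[n] are the trees of height at most n. The only data that matter are the *)
(* triples (unknown, height, size) realised by some tree. A minimal tree of   *)
(* minimal height never needs more than m levels, so Y^[m] already has the    *)
(* valuations of all later iterates, and replacing subtrees by minimal ones   *)
(* shows that all iterates are species as soon as Y^[m+1] is.                 *)
(*   Say that j-trees graft into i-trees if each of them extends to a taller  *)
(* i-tree of the same size. If i grafts into itself for some productive i,    *)
(* then minimal i-trees have unbounded height and the iteration does not      *)
(* converge. Otherwise grafting is a strict order on the m productive         *)
(* unknowns. Down a longest branch of a minimal tree, each step lowers either *)
(* the valuation or, at equal valuation, the rank in this order, so minimal   *)
(* trees have height at most m (that is, the leading terms of Y^[m] and       *)
(* Y^[m+1] agree). Down any branch, at most m consecutive trees have the same *)
(* size, so a tree of size s has height at most m (s + 1), which gives        *)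
(* convergence.                                                               *)

Set Implicit Arguments.
Unset Strict Implicit.
Unset Printing Implicit Defensive.

Local Open Scope quotient_scope.

(** Everything reduces to which triples [tree i h s] exist. The sizes in [iterate H n i] are those
    of trees of height at most [n] ([iterate_sizeP]), and [embed H n i] misses structures exactly at
    the sizes of trees of height [n.+1] ([tree_iterate], [embed_onto]). As iterates have finite
    values ([iterate_finite]), any isomorphism between restrictions of consecutive iterates forces
    the embedding to be onto there ([restrict_iso_onto]). Hence equality of leading terms
    ([leading_term_isoP]) and well-foundedness ([well_founded_bounded], [bounded_well_founded]) both
    amount to [min_height_bounded H m]; convergence comes from the height bound [height_le]. *)

(** * Natural maps and their images *)

Record nattrans (K : Type) (F G : prespecies K) := Nattrans {
  nt_fun :> forall U : sset K, F U -> G U;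
  nt_natural : forall U V (f : sbij U V) (x : F U),
    nt_fun (transport F f x) = transport G f (nt_fun x) }.

Definition nattrans_id (K : Type) (F : prespecies K) : nattrans F F :=
  @Nattrans K F F (fun _ x => x) (fun _ _ _ _ => erefl).

Definition nattrans_empty (K : Type) (F : prespecies K) :
    nattrans (empty_species K) F :=
  @Nattrans K (empty_species K) F (fun _ x => match x with end)
    (fun _ _ _ x => match x with end).

Definition in_image (K : Type) (F G : prespecies K) (phi : nattrans F G)
    (U : sset K) (y : G U) : Prop := exists x, phi U x = y.

Definition sbij_sym (K : Type) (U V : sset K) (f : sbij U V) : sbij V U :=
  @SBij K V U (bij_sym f)
    (fun v => etrans (esym (sbij_sort f _)) (congr1 sort_of (bij_invK f v))).

Lemma transport_symK (K : Type) (F : prespecies K) (U V : sset K)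
    (f : sbij U V) : cancel (transport F f) (transport F (sbij_sym f)).
Proof.
move=> x; rewrite -transport_comp -[RHS]transport_id; congr transport.
by apply: sbij_ext => u /=; rewrite bij_funK.
Qed.

Lemma in_image_transport (K : Type) (F G : prespecies K) (phi : nattrans F G)
    (U V : sset K) (f : sbij U V) (y : G U) :
  in_image phi y -> in_image phi (transport G f y).
Proof. by case=> x <-; exists (transport F f x); rewrite nt_natural. Qed.

(** * Functoriality of substitution in the inner species *)

Section SubstFunctor.
Variables (K L : Type) (F : prespecies L) (G G' : L -> prespecies K).
Variable phi : forall l, nattrans (G l) (G' l).

Local Notation pi_ H U := (\pi_({eq_quot (@same_assembly_equiv _ _ F H U)})).

Definition assembly_map (U : sset K) (a : assembly F G U) : assembly F G' U :=
  @Assembly _ _ F G' U (nblocks a) (@block_sort _ _ _ _ _ a) (outer a)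
    (@block_of _ _ _ _ _ a) (fun j => phi _ _ (inner j)).

Lemma assembly_map_renumber U (a : assembly F G U) t :
  assembly_map (renumber (x := a) t) = renumber (x := assembly_map a) t.
Proof.
case: a t => n s o h i t; apply: assembly_eq => //= j; exact: nt_natural.
Qed.

Lemma assembly_map_transport U V (f : sbij U V) (a : assembly F G U) :
  assembly_map (assembly_transport f a) = assembly_transport f (assembly_map a).
Proof. by case: a => n s o h i; apply: assembly_eq => //= j; exact: nt_natural.
Qed.

Definition subst_map (U : sset K) (c : subst F G U) : subst F G' U :=
  pi_ G' U (assembly_map (repr c)).

Lemma subst_map_pi U (a : assembly F G U) :
  subst_map (pi_ G U a) = pi_ G' U (assembly_map a).
Proof.
apply/eqmodP/asboolP.
have /eqmodP/asboolP[t e] : repr (pi_ G U a) = a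
    %[mod {eq_quot (@same_assembly_equiv _ _ F G U)}] by rewrite reprK.
by exists t; rewrite {1}e assembly_map_renumber.
Qed.

Lemma subst_map_natural U V (f : sbij U V) (c : subst F G U) :
  subst_map (transport (subst F G) f c) = transport (subst F G') f (subst_map c).
Proof.
rewrite -[c]reprK /= subst_transport_pi !subst_map_pi subst_transport_pi.
by rewrite assembly_map_transport.
Qed.

Definition subst_nattrans : nattrans (subst F G) (subst F G') :=
  Nattrans subst_map_natural.

(** Renumbering only transports inner structures, and images are stable under transport, so the
    criterion can be read off any representative. *)
Lemma in_image_subst U (a : assembly F G' U) :
  in_image subst_nattrans (pi_ G' U a) <->
  forall j, in_image (phi (@block_sort _ _ _ _ _ a j)) (inner j).
Proof.
split=> [[c]|].
  rewrite -[c]reprK /= subst_map_pi => /eqmodP/asboolP[t ->] j.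
  by apply: in_image_transport; eexists.
case: a => n s o h i /= im; pose i' j := sval (cid (im j)).
exists (pi_ G U (@Assembly _ _ F G U n s o h i')).
rewrite /= subst_map_pi; congr \pi; apply: assembly_eq => // j.
exact: svalP (cid (im j)).
Qed.

(* When [phi] is injective, [lift x] is a subsingleton depending on [x]       *)
(* alone, so injectivity of [assembly_map] needs no inversion of an equation  *)
(* between records with dependent fields.                                     *)
Let lift U (x : assembly F G' U) : Type :=
  {i : forall j, G (@block_sort _ _ _ _ _ x j) (fibre (@block_of _ _ _ _ _ x) j)
   | forall j, phi _ _ (i j) = inner j}.

Let unlift U (x : assembly F G' U) (l : lift x) : assembly F G U :=
  @Assembly _ _ F G U (nblocks x) (@block_sort _ _ _ _ _ x) (outer x)
    (@block_of _ _ _ _ _ x) (sval l).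

Lemma assembly_map_inj U :
  (forall l U, injective (phi l U)) -> injective (@assembly_map U).
Proof.
move=> phi_inj.
have unlift_eq x y (e : x = y) (lx : lift x) (ly : lift y) :
    unlift lx = unlift ly.
  case: _ / e ly => ly; apply: assembly_eq => // j.
  by apply: (phi_inj); rewrite (svalP lx) (svalP ly).
pose la (a : assembly F G U) : lift (assembly_map a) :=
  exist _ (@inner _ _ _ _ _ a) (fun=> erefl).
have unliftK a : unlift (la a) = a by case: a.
by move=> a b e; rewrite -[a]unliftK -[b]unliftK; apply: unlift_eq.
Qed.

Lemma subst_nattrans_inj :
  (forall l U, injective (phi l U)) -> forall U, injective (subst_nattrans U).
Proof.
move=> phi_inj U c d; rewrite -[c]reprK -[d]reprK /= !subst_map_pi.
move=> /eqmodP/asboolP[t]; rewrite -assembly_map_renumber.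
by move/(assembly_map_inj phi_inj) => e; apply/eqmodP/asboolP; exists t.
Qed.

End SubstFunctor.

(** * Assemblies with prescribed blocks *)

Section Coproduct.
Variables (K L : Type) (F : prespecies L) (G : L -> prespecies K).
Variables (k : nat) (s : 'I_k -> L) (W : 'I_k -> sset K).
Variables (o : F (SSet s)) (w : forall b, G (s b) (W b)).

(** On a disjoint union the fibres of the tag are copies of the prescribed supports, so any choice
    of block structures is realised by an assembly. *)
Definition coprod_sset : sset K :=
  @SSet K {b : 'I_k & W b} (fun u => sort_of (tagged u)).

Let h (u : coprod_sset) : 'I_k := tag u.

Lemma card_coprod_sset : #|coprod_sset| = \sum_b #|W b|.
Proof. by rewrite card_tagged sumnE big_map big_enum. Qed.

Let to_fibre b (u : W b) : fibre h b := exist _ (Tagged W u : coprod_sset) (eqxx b).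

Let of_fibre b (u : fibre h b) : W b := etagged (eqP (valP u)).

Let to_fibreK b : cancel (@to_fibre b) (@of_fibre b).
Proof. by move=> u; rewrite /of_fibre /etagged /= (eq_irrelevance (eqP _) erefl). Qed.

Let of_fibreK b : cancel (@of_fibre b) (@to_fibre b).
Proof.
move=> [[b' u] /= e]; apply: val_inj => /=; rewrite /of_fibre /=.
by move: (eqP _); rewrite /h /= => e'; case: _ / e'.
Qed.

Let fibre_sbij b : sbij (W b) (fibre h b) :=
  @SBij K (W b) (fibre h b) (Bij (@to_fibreK b) (@of_fibreK b)) (fun=> erefl).

Definition coprod_assembly : assembly F G coprod_sset :=
  @Assembly _ _ F G coprod_sset k s o h
    (fun b => transport (G (s b)) (fibre_sbij b) (w b)).

Lemma in_image_coprod (G' : L -> prespecies K)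
    (phi : forall l, nattrans (G' l) (G l)) (b : 'I_k) :
  in_image (phi (s b)) (@inner _ _ _ _ _ coprod_assembly b) ->
  in_image (phi (s b)) (w b).
Proof.
by move=> /(in_image_transport (sbij_sym (fibre_sbij b))); rewrite transport_symK.
Qed.

End Coproduct.

Definition update (T : finType) (X : Type) (f : T -> X) (b : T) (x : X) : T -> X :=
  fun c => if c == b then x else f c.

Lemma update_eq (T : finType) X (f : T -> X) b x : update f b x b = x.
Proof. by rewrite /update eqxx. Qed.

Lemma sum_update (I : finType) (f : I -> nat) (b : I) (x : nat) :
  \sum_c update f b x c + f b = \sum_c f c + x.
Proof.
rewrite (bigD1 b) //= update_eq [in RHS](bigD1 b) //=.
rewrite (eq_bigr f) => [|c /negPf nb]; last by rewrite /update nb.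
lia.
Qed.

Lemma card_lt_ord m (A : {set 'I_m}) (i : 'I_m) : i \notin A -> #|A| < m.
Proof.
move=> iA; have /proper_card : A \proper [set: 'I_m].
  by apply/properP; split; [exact: finset.subsetT | exists i; rewrite ?inE].
by rewrite cardsT card_ord.
Qed.

(** * Heights and sizes of trees *)

Section Trees.
Variables (K : Type) (m : nat) (H : 'I_m -> prespecies (K + 'I_m)%type).

(* [tree i h s]: some structure of the [i]-th unknown has height [h] (it      *)
(* first occurs in the [h]-th iterate) and size [s].                          *)
Inductive tree : 'I_m -> nat -> nat -> Prop :=
  Tree i k (bs : 'I_k -> (K + 'I_m)%type) (ht sz : 'I_k -> nat) :
    inhabited (H i (SSet bs)) ->
    (forall b a, bs b = inl a -> ht b = 0 /\ sz b = 1) ->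
    (forall b j, bs b = inr j -> tree j (ht b) (sz b)) ->
    tree i (\max_b ht b).+1 (\sum_b sz b).

(** The premises of [Tree], bundled so that blocks can be replaced before the height and size are
    computed. *)
Definition node i k (bs : 'I_k -> (K + 'I_m)%type) (ht sz : 'I_k -> nat) :=
  [/\ inhabited (H i (SSet bs)),
      (forall b a, bs b = inl a -> ht b = 0 /\ sz b = 1) &
      (forall b j, bs b = inr j -> tree j (ht b) (sz b))].

Lemma treeP i h s : tree i h s <->
  exists k bs ht sz, [/\ @node i k bs ht sz, h = (\max_b ht b).+1
                       & s = \sum_b sz b].
Proof.
split=> [[{}i k bs ht sz Hi la ra]|[k [bs [ht [sz [[Hi la ra] -> ->]]]]]].
  by exists k, bs, ht, sz.
exact: (Tree (bs := bs)).
Qed.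

Lemma node_update i k bs ht sz (b : 'I_k) j h s :
  @node i k bs ht sz -> bs b = inr j -> tree j h s ->
  node i bs (update ht b h) (update sz b s).
Proof.
move=> [Hi la ra] bj tj; split=> // c.
  by move=> a ca; rewrite /update; case: eqP => [cb|_]; 
    [rewrite cb bj in ca | exact: la ca].
by move=> l cl; rewrite /update; case: eqP => [cb|_];
   [move: cl; rewrite cb bj => -[<-] | exact: ra].
Qed.

(** A positive maximum rules out a node without blocks, and atoms have height 0, so a tallest block
    carries a subtree. *)
Lemma node_max i k bs ht sz :
  @node i k bs ht sz -> 0 < \max_b ht b ->
  exists b j, [/\ bs b = inr j, ht b = \max_b ht b & tree j (ht b) (sz b)].
Proof.
case: k bs ht sz => [|k] bs ht sz [_ la ra]; first by rewrite big_ord0.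
have [|b eb] := @eq_bigmax 'I_k.+1 ht; first by rewrite card_ord.
rewrite eb => h_gt0; exists b; case bb : (bs b) => [a|j].
  by have [h0 _] := la _ _ bb; rewrite h0 in h_gt0.
by exists j; split=> //; exact: ra.
Qed.

Definition productive i := exists h s, tree i h s.

(** The value 0 is a placeholder for unproductive unknowns. *)
Definition minsize i : nat :=
  if pselect (exists s, `[< exists h, tree i h s >]) is left ex
  then ex_minn ex else 0.

Lemma minsize_le i h s : tree i h s -> minsize i <= s.
Proof.
rewrite /minsize => t; case: pselect => // ex; case: ex_minnP => v _.
by apply; apply/asboolP; exists h.
Qed.

Lemma minsize_tree i : productive i -> exists h, tree i h (minsize i).
Proof.
rewrite /minsize => -[h [s t]]; case: pselect => [ex|[]]; last first.
  by exists s; apply/asboolP; exists h.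
by case: ex_minnP => v /asboolP.
Qed.

(** The minimum is over trees of minimal size only, not over all trees. *)
Definition minheight i : nat :=
  if pselect (exists h, `[< tree i h (minsize i) >]) is left ex
  then ex_minn ex else 0.

Lemma minheight_le i h : tree i h (minsize i) -> minheight i <= h.
Proof.
rewrite /minheight => t; case: pselect => // ex; case: ex_minnP => v _.
by apply; apply/asboolP.
Qed.

Lemma minheight_tree i : productive i -> tree i (minheight i) (minsize i).
Proof.
rewrite /minheight => /minsize_tree[h t]; case: pselect => [ex|[]]; last first.
  by exists h; apply/asboolP.
by case: ex_minnP => v /asboolP.
Qed.

(** Otherwise replacing the subtree by a minimal one would give a smaller [i]-tree. *)
Lemma node_minsize i k bs ht sz (b : 'I_k) j :
  @node i k bs ht sz -> \sum_b sz b = minsize i -> bs b = inr j ->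
  sz b = minsize j.
Proof.
move=> n e bj; have tj : tree j (ht b) (sz b) by case: (n) => _ _; apply.
have [|h0 t0] := @minsize_tree j; first by exists (ht b), (sz b).
have le_j := minsize_le tj.
have nu := node_update n bj t0.
have /minsize_le : tree i (\max_c update ht b h0 c).+1
    (\sum_c update sz b (minsize j) c).
  by apply/treeP; exists k, bs, (update ht b h0), (update sz b (minsize j)).
have := sum_update sz b (minsize j); lia.
Qed.

Definition graft i j :=
  forall h s, tree j h s -> exists2 h', h < h' & tree i h' s.

Lemma graft_trans i j l : graft i j -> graft j l -> graft i l.
Proof.
move=> ij jl h s /jl[h1 hh1 /ij[h2 h12 t]]; exists h2 => //; exact: ltn_trans h12.
Qed.

(** Descent to a tallest block. Minimality passes to it by [node_minsize]; the last clause records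
    that each level costs either size or a graft, which is what bounds heights. *)
Lemma tree_child i h s : tree i h.+1 s -> 0 < h ->
  exists j s', [/\ tree j h s', s' <= s, s = minsize i -> s' = minsize j
                 & s' = s -> graft i j].
Proof.
move=> /treeP[k [bs [ht [sz [n [->] ->]]]]] h_gt0.
have [b [j [bj hb tj]]] := node_max n h_gt0.
exists j, (sz b); split; first by rewrite -hb.
- by rewrite (bigD1 b) //= leq_addr.
- by move=> e; exact: node_minsize n e bj.
(* Block [b] carries the whole size, so the other blocks total 0, and any [j]-tree put in its place
   gives a taller [i]-tree of the same size as that [j]-tree. *)
move=> eb h1 s1 t1; exists (\max_c update ht b h1 c).+1.
  by rewrite ltnS -{1}[h1](update_eq ht b h1) leq_bigmax.
apply/treeP; exists k, bs, (update ht b h1), (update sz b s1); split=> //.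
  exact: node_update t1.
by have := sum_update sz b s1; lia.
Qed.

(** In a tree realising [minheight i], the subtrees can be taken of least height too. The tallest
    one then has [minheight] exactly one less, so the sets [low] strictly decrease along the
    branch. *)
Lemma minheight_le_m i : productive i -> minheight i <= m.
Proof.
pose low i := [set j | `[< productive j /\ minheight j < minheight i >]].
have low_lt j : #|low j| < m.
  apply: (@card_lt_ord _ _ j); rewrite finset.in_set; apply/asboolP.
  by rewrite ltnn => -[].
suff hle n : forall i, minheight i = n -> productive i ->
    minheight i <= #|low i|.+1.
  by move=> pi; apply: leq_trans (hle _ _ erefl pi) (low_lt i).
elim/ltn_ind: n => n IH {}i ei pi.
have /treeP[k [bs [ht [sz [nd hi si]]]]] := minheight_tree pi.
have min_b b j : bs b = inr j -> sz b = minsize j.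
  by apply: node_minsize nd _; rewrite si.
have tr_b b j : bs b = inr j -> tree j (ht b) (sz b) by case: nd => _ _; apply.
pose ht' b := if bs b is inr j then minheight j else 0.
have nd' : node i bs ht' sz.
  case: nd => Hi la ra; split=> // b.
    by move=> a ba; rewrite /ht' ba; have [_ ->] := la _ _ ba.
  move=> j bj; rewrite /ht' bj (min_b b j bj); apply: minheight_tree.
  by exists (ht b), (sz b); exact: ra.
have /minheight_le le_i : tree i (\max_b ht' b).+1 (minsize i).
  by apply/treeP; exists k, bs, ht', sz.
have [z|nz] := posnP (\max_b ht' b).
  by rewrite z in le_i; exact: leq_trans le_i _.
have [b [j [bj hb tj]]] := node_max nd' nz.
have hj : ht' b = minheight j by rewrite /ht' bj.
have pj : productive j by exists (ht' b), (sz b).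
have lt_ji : minheight j < minheight i.
  rewrite hi ltnS; apply: leq_trans (leq_bigmax b).
  by apply: minheight_le; rewrite -(min_b b j bj); exact: tr_b.
have le_ij : minheight i <= (minheight j).+1 by rewrite -hj hb.
have IHj : minheight j <= #|low j|.+1 by apply: (IH (minheight j)); rewrite -?ei.
apply: (leq_trans le_ij); rewrite ltnS; apply: (leq_trans IHj).
apply: proper_card; apply/properP; split; last first.
  exists j; rewrite !finset.in_set; first by apply/asboolP.
  by apply/asboolP; rewrite ltnn => -[].
apply/fintype.subsetP => l; rewrite !finset.in_set => /asboolP[pl lt_lj]; apply/asboolP.
by split=> //; exact: ltn_trans lt_ji.
Qed.

Definition min_height_bounded n :=
  forall i h, tree i h (minsize i) -> h <= n.

(** A minimal tree has a minimal child exactly one level lower, so a minimal tree higher than [m]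
    would contain one of height [m.+1]. *)
Lemma min_height_bounded_succ :
  (forall i, ~ tree i m.+1 (minsize i)) -> min_height_bounded m.
Proof.
move=> no i h; elim: h i => // h IH i t.
have [h0|h_gt0] := posnP h; first by have := ltn_ord i; lia.
have [j [s' [tj _ /(_ erefl) e _]]] := tree_child t h_gt0.
rewrite e in tj; have := IH _ tj; rewrite leq_eqVlt => /orP[/eqP hm|//].
by case: (no i); rewrite -hm.
Qed.

Section Bounded.
Variables (n : nat) (bounded : min_height_bounded n).

Lemma graft_irrefl i : productive i -> ~ graft i i.
Proof.
move=> /minsize_tree[h0 t0] g.
suff [h lt_nh /bounded] : exists2 h, n < h & tree i h (minsize i) by lia.
elim: n => [|q [h lt_qh /g[h' hh' t]]].
  by have [h' ? ?] := g _ _ t0; exists h' => //; lia.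
by exists h' => //; lia.
Qed.

(** Any bound [n] sharpens to [m]. Bounded heights make grafting irreflexive on productive unknowns,
    so descending to a tallest child strictly shrinks [below], the predecessors for the
    lexicographic order on minimal size, then grafting. *)
Lemma min_height_le_m : min_height_bounded m.
Proof.
pose below i := [set j | `[< productive j /\
  (minsize j < minsize i \/ minsize j = minsize i /\ graft i j) >]].
suff hle h : forall i, tree i h (minsize i) -> h <= #|below i|.+1.
  move=> i h t; apply: leq_trans (hle _ _ t) _.
  apply: (@card_lt_ord _ _ i); rewrite finset.in_set; apply/asboolP.
  by rewrite ltnn => -[pi [//|[_]]]; exact: graft_irrefl.
elim: h => // h IH i t; have [->//|h_gt0] := posnP h.
have [j [s' [tj le_s /(_ erefl) e g]]] := tree_child t h_gt0.
rewrite {}e in tj le_s g; have pj : productive j by exists h, (minsize j).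
rewrite ltnS; apply: (leq_trans (IH _ tj)); apply: proper_card.
have j_below : j \in below i.
  rewrite finset.in_set; apply/asboolP; split=> //.
  by move: le_s; rewrite leq_eqVlt => /orP[/eqP ej|]; [right; split; [|exact: g] | left].
apply/properP; split; last first.
  exists j => //; rewrite finset.in_set; apply/asboolP.
  by rewrite ltnn => -[_ [//|[_]]]; exact: graft_irrefl.
apply/fintype.subsetP => l; rewrite !finset.in_set => /asboolP[pl C].
apply/asboolP; split=> //.
case: C => [lt_lj|[e gjl]]; first by left; exact: leq_trans le_s.
move: le_s; rewrite leq_eqVlt => /orP[/eqP ej|]; last by left; rewrite e.
by right; rewrite e; split=> //; apply: graft_trans gjl; exact: g.
Qed.

(** Along a tallest branch, each step at constant size shrinks [below], so such a run has at most
    [m] levels, and the size drops at most [s] times. The induction uses the sharper [#|below i|.+1]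
    in place of the final [m]. *)
Lemma height_le i h s : tree i h s -> h <= m * s + m.
Proof.
pose below i := [set j | `[< productive j /\ graft i j >]].
have lt_m j : #|below j| < m.
  case: (pselect (productive j)) => pj.
    apply: (@card_lt_ord _ _ j); rewrite finset.in_set; apply/asboolP => -[_].
    exact: graft_irrefl.
  (* For unproductive [j] the set is empty: a productive [l] grafting into [j] would yield a
     [j]-tree. *)
  rewrite (_ : below j = finset.set0) ?cards0 //; first by case: (m) j {pj} => [[]|].
  apply/finset.setP => l; rewrite finset.in_set0 finset.in_set.
  apply/asboolP => -[[q [r t]] /(_ _ _ t)[q' _ t']].
  by apply: pj; exists q', r.
suff: tree i h s -> h <= m * s + (#|below i|).+1.
  by move=> le /le; have := lt_m i; lia.
elim: h i s => // h IH i s t; have [->|h_gt0] := posnP h; first by rewrite addnS.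
have [j [s' [tj le_s _ g]]] := tree_child t h_gt0; have le_h := IH _ _ tj.
have pj : productive j by exists h, s'.
have := lt_m j; move: le_s; rewrite leq_eqVlt => /orP[/eqP es|lt_s]; last by nia.
suff : #|below j| < #|below i| by rewrite es in le_h; lia.
apply: proper_card; apply/properP; split; last first.
  exists j; rewrite finset.in_set; apply/asboolP; first by split=> //; exact: g.
  by case=> _; exact: graft_irrefl.
apply/fintype.subsetP => l; rewrite !finset.in_set => /asboolP[pl gl]; apply/asboolP.
by split=> //; apply: graft_trans gl; exact: g.
Qed.

End Bounded.

End Trees.

(** * Embeddings between iterates and their trees *)

Lemma card_fibres (K : Type) (U : sset K) n (h : U -> 'I_n) :
  #|U| = \sum_b #|fibre h b|.
Proof.
rewrite -sum1_card (partition_big h xpredT) //=.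
by apply: eq_bigr => b _; rewrite sum1_card card_sig.
Qed.

Section Embeddings.
Variables (K : Type) (m : nat) (H : 'I_m -> prespecies (K + 'I_m)%type).

Definition iterate_sort (n : nat) (l : (K + 'I_m)%type) : prespecies K :=
  match l with inl a => singleton_species a | inr i => iterate H n i end.

Fixpoint embed n : forall i, nattrans (iterate H n i) (iterate H n.+1 i) :=
  match n with
  | 0 => fun i => nattrans_empty _
  | n'.+1 => fun i => @subst_nattrans _ _ (H i) (iterate_sort n')
      (iterate_sort n'.+1)
      (fun l => match l with inl a => nattrans_id _ | inr j => embed n' j end)
  end.

Definition embed_sort n l : nattrans (iterate_sort n l) (iterate_sort n.+1 l) :=
  match l with inl a => nattrans_id _ | inr j => embed n j end.

Lemma embed_inj n i U : injective (embed n i U).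
Proof.
elim: n i U => [|n IH] i U; first by case.
by apply: subst_nattrans_inj => -[a|j] V; [move=> x y | exact: IH].
Qed.

Local Notation pi_ n i U :=
  (\pi_({eq_quot (@same_assembly_equiv _ _ (H i) (iterate_sort n) U)})).

Lemma in_image_embed n i U (a : assembly (H i) (iterate_sort n.+1) U) :
  in_image (embed n.+1 i) (pi_ n.+1 i U a : iterate H n.+2 i U) <->
  forall b, in_image (embed_sort n (block_sort b)) (@inner _ _ _ _ _ a b).
Proof. exact: in_image_subst. Qed.

(** New at stage [n] means absent from the previous stage. The value [False] at stage 0 is for
    atoms, which are present from the start, in keeping with their height 0. *)
Definition is_new n l (U : sset K) : iterate_sort n l U -> Prop :=
  match n with
  | 0 => fun=> False
  | n'.+1 => fun x => ~ in_image (embed_sort n' l) x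
  end.

Lemma atom_not_new n k U (x : iterate_sort n (inl k) U) : ~ is_new x.
Proof. by case: n x => [|n] x; [case | move=> new; apply: new; exists x]. Qed.

(** The witness [h] is the height of [x]: one more than the largest height of its blocks, and an
    assembly comes from the previous iterate as soon as all its blocks do. *)
Lemma iterate_tree n i U (x : iterate H n i U) : exists h,
  [/\ h <= n, tree H i h #|U| & h < n -> ~ is_new (l := inr i) x].
Proof.
elim: n i U x => [|n IH] i U; first by case.
change (forall x : subst (H i) (iterate_sort n) U, exists h,
  [/\ h <= n.+1, tree H i h #|U| &
      h < n.+1 -> ~ ~ in_image (embed n i) (x : iterate H n.+1 i U)]).
move=> x; rewrite -[x]reprK; move: (repr x) => {x} a.
have : forall b, exists hb,
    [/\ hb <= n,
        forall k, @block_sort _ _ _ _ _ a b = inl k ->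
          hb = 0 /\ #|fibre (block_of a) b| = 1,
        forall j, @block_sort _ _ _ _ _ a b = inr j ->
          tree H j hb #|fibre (block_of a) b| &
        hb < n -> ~ is_new (@inner _ _ _ _ _ a b)].
  move=> b; move: (inner b); case: (block_sort b) => [k|j] y.
    exists 0; split=> // [_ _|_]; first by split=> //; case: y.
    exact: atom_not_new.
  by have [h [hn tj new]] := IH j _ y; exists h; split=> // _ [<-].
move=> /choice[ht htP]; exists (\max_b ht b).+1; split.
- by rewrite ltnS; apply/bigmax_leqP => b _; have [] := htP b.
- rewrite (card_fibres (block_of a)).
  apply: (Tree (bs := @block_sort _ _ _ _ _ a)); first by split; exact: outer a.
    by move=> b k bk; have [_ /(_ k bk)] := htP b.
  by move=> b j bj; have [_ _ /(_ j bj)] := htP b.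
- rewrite ltnS; case: n IH a ht htP => // n IH a ht htP lt_n; apply.
  apply/in_image_embed => b; apply: contrapT; have [_ _ _] := htP b; apply.
  exact: leq_ltn_trans (leq_bigmax b) lt_n.
Qed.

Lemma iterate_size_mono n n' i s : n <= n' ->
  has_structure_of_size (iterate H n i) s ->
  has_structure_of_size (iterate H n' i) s.
Proof.
elim: n' => [|n' IH]; first by rewrite leqn0 => /eqP->.
rewrite leq_eqVlt => /orP[/eqP->//|/IH{}IH /IH[U [Us [x]]]].
by exists U; split=> //; split; exact: embed n' i U x.
Qed.

(** All blocks are brought to the common stage [M], the largest block height, by embedding the lower
    ones. A block of height [M] stays new, and one new block makes the assembly new. *)
Lemma tree_iterate i h s : tree H i h s ->
  exists (U : sset K) (x : iterate_sort h (inr i) U), #|U| = s /\ is_new x.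
Proof.
elim=> {}i k bs ht sz [o] la _ ra; set M := \max_b ht b.
have W_ b : exists (W : sset K) (w : iterate_sort M (bs b) W),
    #|W| = sz b /\ (ht b = M -> 0 < M -> is_new w).
  case eb : (bs b) => [a|j].
    have [h0 s1] := la b a eb.
    have W1 : is_singleton a (@SSet K unit (fun=> a)).
      by split=> //; rewrite card_unit.
    by exists (@SSet K unit (fun=> a)), W1; rewrite card_unit h0; split=> // <-.
  have [U [x [Us xnew]]] := ra b j eb.
  have [eM|neM] := eqVneq (ht b) M.
    by case: _ / eM; exists U, x.
  have [|V [Vs [y]]] := @iterate_size_mono (ht b) M j (sz b) (leq_bigmax b).
    by exists U; split.
  by exists V, y; split=> // e; rewrite e eqxx in neM.
pose W b := sval (cid (W_ b)).
pose w b : iterate_sort M (bs b) (W b) := sval (cid (svalP (cid (W_ b)))).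
have Ww b : #|W b| = sz b /\ (ht b = M -> 0 < M -> is_new (w b)).
  exact: svalP (cid (svalP (cid (W_ b)))).
exists (coprod_sset W), (pi_ M i _ (coprod_assembly o w)); split.
  by rewrite card_coprod_sset; apply: eq_bigr => b _; case: (Ww b).
(* For [M = 0] newness is automatic, since iterate 0 is empty. *)
rewrite /is_new /embed_sort; have [M0|M_gt0] := posnP M.
  by move: (\pi _) => x; case: (M) M0 x => // _ x [[]].
have [|b eb] := @eq_bigmax 'I_k ht.
  rewrite card_ord lt0n; apply: contraTneq M_gt0 => k0.
  rewrite /M big1 // => b _; exfalso.
  by have := ltn_ord b; move: (nat_of_ord b) => q; rewrite k0.
have [_ /(_ (esym eb) M_gt0)] := Ww b.
clear Ww; clearbody w; clearbody W; clearbody M.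
case: M w {W_ M_gt0 eb} => // M' w /= wnew.
move=> /in_image_embed/(_ b) /in_image_coprod.
exact: wnew.
Qed.

Lemma iterate_sizeP n i s : has_structure_of_size (iterate H n i) s <->
  exists2 h, h <= n & tree H i h s.
Proof.
split=> [[U [<- [x]]]|[h hn /tree_iterate[U [x [Us _]]]]].
  by have [h [hn t _]] := iterate_tree x; exists h.
by apply: (iterate_size_mono hn); exists U; split.
Qed.

Lemma embed_onto n i (U : sset K) :
  ~ tree H i n.+1 #|U| ->
  forall y : iterate H n.+1 i U, in_image (embed n i) y.
Proof.
move=> no y; have [h [hn t new]] := iterate_tree y; apply: contrapT.
by apply: new; rewrite ltn_neqAle hn andbT; apply: contra_not_neq no => <-.
Qed.

End Embeddings.

(** * Finiteness of types *)

Lemma finite_enum (T : Type) : finite_set [set: T] ->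
  exists2 s : seq {classic T}, uniq s & forall x, x \in s.
Proof.
move=> fT; have /finite_seqP[s es] : finite_set [set: {classic T}] by [].
exists (undup s) => [|x]; first exact: undup_uniq.
by rewrite mem_undup; have : [set: {classic T}]%classic x by []; rewrite es.
Qed.

(** Being an image of a [finType] passes easily to dependent sums and products of bare types, which
    have no equality test. *)
Lemma finite_surjP (T : Type) : finite_set [set: T] <->
  exists (I : finType) (f : I -> T), forall x, exists i, f i = x.
Proof.
split=> [fT|[I [f fsurj]]]; last first.
  have -> : [set: T]%classic = [set f i | i in [set: I]]%classic.
    by apply/seteqP; split=> // x _; have [i <-] := fsurj x; exists i.
  exact/finite_image/finite_finset.
have [s _ mem_s] := finite_enum fT.
exists 'I_(size s), (fun i => tnth (in_tuple s) i) => x0.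
pose x : {classic T} := x0; have := mem_s x; rewrite -index_mem => lt_x.
by exists (Ordinal lt_x); rewrite (tnth_nth x) /= nth_index.
Qed.

Lemma finite_surj (S T : Type) (f : S -> T) :
  finite_set [set: S] -> (forall y, exists x, f x = y) -> finite_set [set: T].
Proof.
move=> /finite_surjP[I [g gP]] fP; apply/finite_surjP; exists I, (f \o g) => y.
by have [x <-] := fP y; have [i <-] := gP x; exists i.
Qed.

Lemma finite_sigT (I : Type) (T : I -> Type) :
  finite_set [set: I] -> (forall i, finite_set [set: T i]) ->
  finite_set [set: {i : I & T i}].
Proof.
move=> /finite_surjP[J [f fP]] fT.
have g_ i := cid (proj1 (finite_surjP (T i)) (fT i)).
pose D i := sval (g_ i); pose g i : D i -> T i := sval (cid (svalP (g_ i))).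
have gP i : forall x, exists d, g i d = x by exact: svalP (cid (svalP (g_ i))).
apply/finite_surjP; exists {j : J & D (f j)}.
exists (fun d => existT T (f (tag d)) (g _ (tagged d))) => -[i x].
have [j ej] := fP i; case: _ / ej x => x; have [d <-] := gP _ x.
by exists (Tagged (fun j => D (f j)) d).
Qed.

Lemma finite_forall (I : finType) (T : I -> Type) :
  (forall i, finite_set [set: T i]) -> finite_set [set: forall i, T i].
Proof.
move=> fT; have g_ i := cid (proj1 (finite_surjP (T i)) (fT i)).
pose D i := sval (g_ i); pose g i : D i -> T i := sval (cid (svalP (g_ i))).
have gP i : forall x, exists d, g i d = x by exact: svalP (cid (svalP (g_ i))).
apply/finite_surjP; exists {dffun forall i, D i}, 
  (fun (d : {dffun forall i, D i}) i => g i (d i)) => x.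
have d_ i := cid (gP i (x i)); exists [ffun i => sval (d_ i)].
by apply: functional_extensionality_dep => i; rewrite ffunE (svalP (d_ i)).
Qed.

Lemma finite_prod (S T : Type) : finite_set [set: S] -> finite_set [set: T] ->
  finite_set [set: S * T].
Proof.
move=> fS fT; apply: (@finite_surj {x : S & T} _ (fun p => (tag p, tagged p))).
  exact: finite_sigT.
by case=> x y; exists (existT _ x y).
Qed.

Lemma finite_finType (I : finType) : finite_set [set: I].
Proof. exact: finite_finset. Qed.

Lemma finite_inj_onto (T : Type) (f : T -> T) :
  finite_set [set: T] -> injective f -> forall y, exists x, f x = y.
Proof.
move=> fT finj y.
have [s s_uniq mem_s] := finite_enum fT.
pose g : {classic T} -> {classic T} := f.
have [|||_ /(_ y)] := @uniq_min_size {classic T} (map g s) s.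
- by rewrite map_inj_uniq.
- by move=> x _; exact: mem_s.
- by rewrite size_map.
by rewrite mem_s => /mapP[x _ ->]; exists x.
Qed.

(** * Isomorphisms of restrictions, contact and valuation *)

Section SpeciesIso.
Variable K : Type.
Implicit Types F G E : prespecies K.

Lemma species_iso_refl F : species_iso F F.
Proof.
by exists (fun _ x => x); split=> // U; exists (fun x => x).
Qed.

Lemma species_iso_sym F G : species_iso F G -> species_iso G F.
Proof.
case=> phi [bphi nphi].
have inv_ U : exists psi : G U -> F U, cancel (phi U) psi /\ cancel psi (phi U).
  by have [psi ? ?] := bphi U; exists psi.
pose psi U := sval (cid (inv_ U)).
have psiP U : cancel (phi U) (psi U) /\ cancel (psi U) (phi U).
  exact: svalP (cid (inv_ U)).
exists psi; split=> [U|U V f x]; first by have [? ?] := psiP U; exists (phi U).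
have [_ K1] := psiP U; have [K2 _] := psiP V.
by rewrite -{1}(K1 x) -nphi K2.
Qed.

Lemma species_iso_trans F G E :
  species_iso F G -> species_iso G E -> species_iso F E.
Proof.
move=> [phi [bphi nphi]] [psi [bpsi npsi]].
exists (fun U x => psi U (phi U x)); split=> [U|U V f x].
  exact: bij_comp (bpsi U) (bphi U).
by rewrite nphi npsi.
Qed.

Lemma restrict_val_inj (P : pred nat) F (U : sset K) (x y : restrict P F U) :
  sval x = sval y -> x = y.
Proof. by case: x y => [x p] [y q] /= e; apply: eq_exist. Qed.

Lemma restrict_iso (P : pred nat) F G (phi : nattrans F G) :
  (forall U, injective (phi U)) ->
  (forall U : sset K, P #|U| -> forall y : G U, in_image phi y) ->
  species_iso (restrict P F) (restrict P G).
Proof.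
move=> phi_inj phi_onto.
exists (fun (U : sset K) x => exist (fun=> P #|U|) (phi U (sval x)) (svalP x)).
split=> [U|U V f [x p]]; last by apply: eq_exist; rewrite /= nt_natural.
have inv_ (y : restrict P G U) := cid (phi_onto U (svalP y) (sval y)).
exists (fun y => exist (fun=> P #|U|) (sval (inv_ y)) (svalP y)).
  by case=> x p; apply: eq_exist => /=; apply: phi_inj; rewrite (svalP (inv_ _)).
by case=> y p; apply: eq_exist; rewrite /= (svalP (inv_ _)).
Qed.

Lemma restrict_iso_sub (P Q : pred nat) F G : (forall n, Q n -> P n) ->
  species_iso (restrict P F) (restrict P G) ->
  species_iso (restrict Q F) (restrict Q G).
Proof.
move=> QP [phi [bphi nphi]].
pose up E (U : sset K) (x : restrict Q E U) : restrict P E U :=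
  exist (fun=> P #|U|) (sval x) (QP _ (svalP x)).
pose chi (U : sset K) (x : restrict Q F U) : restrict Q G U :=
  exist (fun=> Q #|U|) (sval (phi U (up F U x))) (svalP x).
exists chi; split=> [U|U V f x]; last first.
  apply: eq_exist => /=.
  rewrite (_ : up F V _ = transport (restrict P F) f (up F U x)).
    by rewrite nphi.
  exact: eq_exist.
have [psi K1 K2] := bphi U.
exists (fun y => exist (fun=> Q #|U|) (sval (psi (up G U y))) (svalP y)).
  case=> x q; apply: eq_exist => /=.
  rewrite (_ : up G U _ = phi U (up F U (exist _ x q))) ?K1 //.
  exact: restrict_val_inj.
case=> y q; apply: eq_exist => /=.
rewrite (_ : up F U _ = psi (up G U (exist _ y q))) ?K2 //.
exact: restrict_val_inj.
Qed.

Lemma restrict_size (P : pred nat) F n :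
  has_structure_of_size (restrict P F) n <-> P n /\ has_structure_of_size F n.
Proof.
split=> [[U [<- [[x p]]]]|[p [U [e [x]]]]]; first by split=> //; exists U.
by exists U; split=> //; split; exists x; rewrite e.
Qed.

Lemma species_iso_size F G n : species_iso F G ->
  has_structure_of_size F n -> has_structure_of_size G n.
Proof.
by move=> [phi _] [U [e [x]]]; exists U; split=> //; split; exact: phi U x.
Qed.

Lemma contact_size p F G n : contact p F G -> n <= p ->
  has_structure_of_size F n <-> has_structure_of_size G n.
Proof.
move=> c np; split=> hn.
  have /(species_iso_size c) : has_structure_of_size (restrict (leq^~ p) F) n.
    exact/restrict_size.
  by case/restrict_size.
have /(species_iso_size (species_iso_sym c)) :
  has_structure_of_size (restrict (leq^~ p) G) n by exact/restrict_size.
by case/restrict_size.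
Qed.

(** The given isomorphism is unrelated to [phi], but its inverse composed with [phi] is an injective
    self-map of the finite set [F U], hence onto; so [phi] is onto. *)
Lemma restrict_iso_onto (P : pred nat) F G (phi : nattrans F G) :
  is_species F -> (forall U, injective (phi U)) ->
  species_iso (restrict P F) (restrict P G) ->
  forall U : sset K, P #|U| -> forall y : G U, in_image phi y.
Proof.
move=> fF phi_inj [chi [bchi _]] U pU y; have [psi K1 K2] := bchi U.
have [|x ex] := @finite_inj_onto (F U)
  (fun x => sval (psi (exist (fun=> P #|U|) (phi U x) pU))) (fF U) _
  (sval (psi (exist (fun=> P #|U|) y pU))).
  move=> x1 x2 /= e; apply: phi_inj.
  have : psi (exist _ (phi U x1) pU) = psi (exist _ (phi U x2) pU).
    exact: restrict_val_inj.
  by move/(can_inj K2) => -[].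
exists x.
have : psi (exist _ (phi U x) pU) = psi (exist _ y pU).
  exact: restrict_val_inj.
by move/(can_inj K2) => -[].
Qed.

Lemma valuation_Some F v : has_structure_of_size F v ->
  (forall n, has_structure_of_size F n -> v <= n) -> valuation F = Some v.
Proof.
move=> hv le_v; rewrite /valuation; case: pselect => [ex|[]]; last first.
  by exists v; apply/asboolP.
case: ex_minnP => u /asboolP hu le_u; congr Some; apply/eqP.
by rewrite eqn_leq le_v // le_u //; apply/asboolP.
Qed.

Lemma valuation_None F : (forall n, ~ has_structure_of_size F n) ->
  valuation F = None.
Proof.
move=> no; rewrite /valuation; case: pselect => // ex.
by have [n /asboolP /no] := ex.
Qed.

End SpeciesIso.

(** * All iterates are species *)

Section Finiteness.
Variables (K : Type) (m : nat) (H : 'I_m -> prespecies (K + 'I_m)%type).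
Hypothesis H_species : forall i, is_species (H i).

Lemma singleton_species_finite (a : K) : is_species (singleton_species a).
Proof.
move=> U; apply/finite_surjP; have [p|np] := pselect (is_singleton a U).
  by exists unit, (fun=> p) => q; exists tt; exact: (Prop_irrelevance p q).
by exists void, (fun v : void => match v with end) => q; case: (np q).
Qed.

(* [K] may be infinite, but an atom block has the sort of an atom of [U]. *)
Lemma iterate_finite_of_bound n i (U : sset K) B :
  (forall j, is_species (iterate H n j)) ->
  (forall a : assembly (H i) (iterate_sort H n) U, nblocks a <= B) ->
  finite_set [set: iterate H n.+1 i U].
Proof.
move=> Yfin bound.
pose sigma (d : U + 'I_m) : K + 'I_m :=
  match d with inl u => inl (sort_of u) | inr j => inr j end.
pose code := {k : 'I_B.+1 & {g : 'I_k -> (U + 'I_m)%type & {h : U -> 'I_k &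
  (H i (SSet (sigma \o g)) *
   forall b, iterate_sort H n (sigma (g b)) (fibre h b))%type}}}.
pose decode (c : code) : iterate H n.+1 i U :=
  let: existT k (existT g (existT h (o, w))) := c in
  \pi_({eq_quot (@same_assembly_equiv _ _ (H i) (iterate_sort H n) U)})
    (@Assembly _ _ (H i) (iterate_sort H n) U k (sigma \o g) o h w).
apply: (@finite_surj code _ decode).
  apply: finite_sigT => [|k]; first exact: finite_finType.
  apply: finite_sigT => [|g].
    by apply: finite_forall => _; exact: finite_finType.
  apply: finite_sigT => [|h].
    by apply: finite_forall => _; exact: finite_finType.
  apply: finite_prod; first exact: H_species.
  apply: finite_forall => b; case: (sigma (g b)) => [a|j]; last exact: Yfin.
  exact: singleton_species_finite.
change (forall y : subst (H i) (iterate_sort H n) U,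
  exists x : code, decode x = y).
move=> y; rewrite -[y]reprK; move: (repr y) => {y} -[k bs o h w].
have lt_k : k < B.+1 by exact: bound (@Assembly _ _ _ _ U k bs o h w).
have /choice[g eg] : forall b, exists d, sigma d = bs b.
  move=> b; move: (w b); case: (bs b) => [a|j]; last by exists (inr j).
  case=> /eqP/fintype1P[u _] ua; exists (inl (val u)).
  by rewrite /sigma -(ua u).
have {}eg : sigma \o g = bs by exact/funext.
case: _ / eg in o w *.
by exists (existT _ (Ordinal lt_k) (existT _ g (existT _ h (o, w)))).
Qed.

Lemma nblocks_repr (L : Type) (F : prespecies L) (G : L -> prespecies K) U
    (a : assembly F G U) :
  nblocks (repr (\pi_({eq_quot (@same_assembly_equiv _ _ F G U)}) a))
  = nblocks a.
Proof.
set E := {eq_quot (@same_assembly_equiv _ _ F G U)}.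
have /eqmodP/asboolP[t e] : repr (\pi_E a) = a %[mod E] by rewrite reprK.
by rewrite [in RHS]e.
Qed.

(* Replacing the structures in the blocks by minimal ones of height at most   *)
(* [m] turns an assembly over any iterate into one over the [m]-th, with as   *)
(* many blocks and no larger.                                                 *)
Lemma nblocks_bounded n i (U : sset K) : is_species (iterate H m.+1 i) ->
  exists B, forall a : assembly (H i) (iterate_sort H n) U, nblocks a <= B.
Proof.
move=> Yfin.
have W_ j : exists W : sset K, productive H j ->
    #|W| = minsize H j /\ inhabited (iterate H m j W).
  have [pj|npj] := pselect (productive H j); last first.
    by exists (@SSet K void (fun v => match v with end)) => /npj.
  have [|W [? ?]] := proj2 (iterate_sizeP H m j (minsize H j)); last by exists W.
  by exists (minheight H j); [exact: minheight_le_m | exact: minheight_tree].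
have {W_}[W WP] := choice W_.
(* Only sorts of atoms of [U] or of the chosen minimal supports can occur, so [D] is a finite
   stand-in for [K]. *)
pose D : finType := (U + {j : 'I_m & W j})%type.
pose sortD (d : D) : K :=
  match d with inl u => sort_of u | inr u => sort_of (tagged u) end.
(* A finite stock, up to relabelling, of structures of iterate [m.+1] of size at most [#|U|]; the
   bound is their largest number of blocks. *)
pose cod := {s : 'I_#|U|.+1 & {f : 'I_s -> D &
  iterate H m.+1 i (@SSet K 'I_s (sortD \o f))}}.
pose nb (c : cod) : nat := nblocks (repr
  (tagged (tagged c) : {eq_quot (@same_assembly_equiv _ _ (H i)
     (iterate_sort H m) (@SSet K 'I_(tag c) (sortD \o tag (tagged c))))})).
have /finite_surjP[I [e eP]] : finite_set [set: cod].
  apply: finite_sigT => [|s]; first exact: finite_finType.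
  apply: finite_sigT => [|f]; last exact: Yfin.
  by apply: finite_forall => _; exact: finite_finType.
exists (\max_x nb (e x)) => a.
suff [c <-] : exists c : cod, nb c = nblocks a.
  by have [x <-] := eP c; exact: leq_bigmax.
pose V b : sset K := match @block_sort _ _ _ _ _ a b with
  | inl k => @SSet K unit (fun=> k) | inr j => W j end.
have VP b : inhabited (iterate_sort H m (block_sort b) (V b)) /\
    #|V b| <= #|fibre (block_of a) b|.
  rewrite /V; move: (inner b); case: (block_sort b) => [k|j] y.
    rewrite card_unit; case: y => -> _; split=> //; split.
    by split=> //; rewrite card_unit.
  have [h [_ t _]] := iterate_tree y.
  have [|-> ?] := WP j; first by exists h, #|fibre (block_of a) b|.
  by split=> //; exact: minsize_le t.
pose w b := inhabited_witness (proj1 (VP b)).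
pose x := \pi_({eq_quot (@same_assembly_equiv _ _ (H i) (iterate_sort H m) _)})
  (coprod_assembly (outer a) w).
pose C := coprod_sset V.
have le_C : #|C| < #|U|.+1.
  rewrite ltnS card_coprod_sset (card_fibres (block_of a)).
  by apply: leq_sum => b _; case: (VP b).
have /choice[d dP] : forall v : C, exists d : D, sortD d = sort_of v.
  case=> b; rewrite /sort_of /= /V; move: (inner b).
  case: (block_sort b) => [k|j] y v; last first.
    by exists (inr (Tagged (fun j => W j) v)).
  by case: y => /eqP/fintype1P[u _] uk; exists (inl (val u)); rewrite -(uk u).
pose f (q : 'I_#|C|) := d (enum_val q).
have rank_sort v : sort_of (enum_rank v : @SSet K 'I_#|C| (sortD \o f)) = sort_of v.
  by rewrite /sort_of /= /f enum_rankK dP.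
pose r : sbij C (@SSet K 'I_#|C| (sortD \o f)) :=
  @SBij K C (@SSet K 'I_#|C| (sortD \o f))
    (Bij (@enum_rankK C) (@enum_valK C)) rank_sort.
exists (existT _ (Ordinal le_C) (existT _ f (subst_transport r x))).
by rewrite /nb /= /x subst_transport_pi nblocks_repr.
Qed.

Lemma iterate_finite : (forall i, is_species (iterate H m.+1 i)) ->
  forall n i, is_species (iterate H n i).
Proof.
move=> Yfin; elim=> [|n IH] i U.
  apply/finite_surjP; exists void.
  by exists (fun v : void => match v with end); case.
have [B bound] := nblocks_bounded n U (Yfin i).
exact: iterate_finite_of_bound IH bound.
Qed.

End Finiteness.

(** * The limit species, glued size by size *)

Section Glue.
Variables (K : Type) (G : nat -> prespecies K).

(* The structures on [U] are those of [G #|U|]; the sigma type avoids casts   *)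
(* along [#|U| = #|V|] in transports.                                         *)
Definition glue_structures (U : sset K) : Type :=
  {k : nat & restrict (pred1 k) (G k) U}.

Definition glue_transport (U V : sset K) (f : sbij U V)
    (x : glue_structures U) : glue_structures V :=
  existT (fun k => restrict (pred1 k) (G k) V) (projT1 x)
    (transport (restrict (pred1 (projT1 x)) (G (projT1 x))) f (projT2 x)).

Lemma glue_transport_id U x : glue_transport (sbij_id U) x = x.
Proof. by case: x => k x; congr existT; rewrite /= restrict_transport_id. Qed.

Lemma glue_transport_comp U V W (g : sbij V W) (f : sbij U V) x :
  glue_transport (sbij_comp g f) x = glue_transport g (glue_transport f x).
Proof. by case: x => k x; congr existT; rewrite /= restrict_transport_comp. Qed.

Definition glue : prespecies K :=
  Prespecies glue_transport_id glue_transport_comp.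

Lemma glue_finite : (forall k, is_species (G k)) -> is_species glue.
Proof.
move=> fG U; apply: (@finite_surj (G #|U| U) _
  (fun x => existT _ #|U| (exist (fun=> pred1 #|U| #|U|) x (eqxx #|U|)))).
  exact: fG.
case=> k [x e]; have /eqP ek : #|U| == k by [].
case: _ / ek x e => x e; exists x; congr existT; exact: restrict_val_inj.
Qed.

(** Transport preserves size, so isomorphisms chosen independently for each size combine into a
    natural one. *)
Lemma glue_iso (P : pred nat) (F : prespecies K) :
  (forall k, P k -> species_iso (restrict (pred1 k) (G k))
                                (restrict (pred1 k) F)) ->
  species_iso (restrict P glue) (restrict P F).
Proof.
move=> iso.
pose phi k (p : P k) := sval (cid (iso k p)).
have phiP k (p : P k) : (forall U, bijective (phi k p U)) /\
    (forall U V (f : sbij U V) (x : restrict (pred1 k) (G k) U),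
       phi k p V (transport _ f x) = transport _ f (phi k p U x)).
  exact: svalP (cid (iso k p)).
have Pk U (x : glue U) : P #|U| -> P (projT1 x).
  by case: x => k [x e] /=; have /eqP <- : #|U| == k by [].
pose chi (U : sset K) (x : restrict P glue U) : restrict P F U :=
  exist (fun=> P #|U|)
    (sval (phi _ (Pk U (sval x) (svalP x)) U (projT2 (sval x)))) (svalP x).
exists chi; split=> [U|U V f [[k x] p]]; last first.
  apply: restrict_val_inj => /=; set q := Pk V _ _; set q' := Pk U _ _.
  have [_ nat_k] := phiP k q'.
  by rewrite (bool_irrelevance q q') /= nat_k.
have e : pred1 #|U| #|U| by exact: eqxx.
have psi_ (p : P #|U|) : exists psi, cancel (phi _ p U) psi /\ cancel psi (phi _ p U).
  by have [/(_ U)[psi ? ?] _] := phiP _ p; exists psi.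
pose psi p := sval (cid (psi_ p)).
have psiP p : cancel (phi _ p U) (psi p) /\ cancel (psi p) (phi _ p U).
  exact: svalP (cid (psi_ p)).
exists (fun y => exist (fun=> P #|U|) (existT _ #|U|
  (psi (svalP y) (exist (fun=> pred1 #|U| #|U|) (sval y) e))) (svalP y)).
  case=> [[k x] p]; apply: restrict_val_inj => /=.
  have /eqP ek : #|U| == k by exact: svalP x.
  move: (Pk U _ _); rewrite /=; case: _ / ek x => x q.
  congr existT; have [K1 _] := psiP p; rewrite -[RHS]K1.
  congr psi; first exact: bool_irrelevance.
  by apply: restrict_val_inj; rewrite /= (bool_irrelevance q p).
case=> y p; apply: restrict_val_inj => /=; move: (Pk U _ _) => q.
set p' := svalP _; have [_ K2] := psiP p'.
by rewrite (bool_irrelevance q p') K2.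
Qed.

End Glue.

(** * Leading terms and convergence *)

Section Convergence.
Variables (K : Type) (m : nat) (H : 'I_m -> prespecies (K + 'I_m)%type).

(** By [minheight_le_m] the minimal sizes are already reached at stage [m]. *)
Lemma valuation_iterate n i : m <= n -> valuation (iterate H n i) =
  if `[< productive H i >] then Some (minsize H i) else None.
Proof.
move=> mn; case: asboolP => [pi|npi].
  apply: valuation_Some => [|s /iterate_sizeP[h _ /minsize_le//]].
  apply/iterate_sizeP; exists (minheight H i); last exact: minheight_tree.
  exact: leq_trans (minheight_le_m pi) mn.
by apply: valuation_None => s /iterate_sizeP[h _ t]; apply: npi; exists h, s.
Qed.

Lemma iterate_restrict_iso (P : pred nat) n n' i : n <= n' ->
  (forall q s, n <= q -> P s -> ~ tree H i q.+1 s) ->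
  species_iso (restrict P (iterate H n i)) (restrict P (iterate H n' i)).
Proof.
move=> + no; elim: n' => [|n' IH].
  by rewrite leqn0 => /eqP->; exact: species_iso_refl.
rewrite leq_eqVlt => /orP[/eqP->|nn']; first exact: species_iso_refl.
apply: species_iso_trans (IH nn') _.
apply: (restrict_iso (phi := embed H n' i)) => [U|U pU y]; first exact: embed_inj.
by apply: embed_onto; exact: no.
Qed.

Lemma iterate_iso_no_tree (P : pred nat) n i s : is_species (iterate H n i) ->
  species_iso (restrict P (iterate H n i)) (restrict P (iterate H n.+1 i)) ->
  P s -> ~ tree H i n.+1 s.
Proof.
move=> Yfin iso ps /tree_iterate[U [x [Us xnew]]]; apply: xnew.
apply: (restrict_iso_onto (phi := embed H n i) Yfin _ iso); last by rewrite Us.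
exact: embed_inj.
Qed.

(** Both stages have the same valuations, so their leading terms restrict to the same size, and they
    agree exactly when no minimal tree has height [m.+1]. *)
Lemma leading_term_isoP : (forall i, is_species (iterate H m i)) ->
  (forall i, species_iso (leading_term (iterate H m i))
                         (leading_term (iterate H m.+1 i)))
  <-> min_height_bounded H m.
Proof.
move=> Yfin; split=> [iso|bd i].
  apply: min_height_bounded_succ => i t; move: (iso i) (t).
  rewrite /leading_term !valuation_iterate // => /iterate_iso_no_tree; apply=> //.
  by case: asboolP => // -[]; exists m.+1, (minsize H i).
rewrite /leading_term !valuation_iterate //; apply: iterate_restrict_iso => // q s mq.
by case: asboolP => // _ /eqP[<-] /bd; lia.
Qed.

Lemma well_founded_bounded : well_founded_system H -> min_height_bounded H m.
Proof.
(* At an order covering all minimal sizes, iterates from [N] on are in contact with [S], hence with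
   each other, so no minimal tree is higher than [N]; [min_height_le_m] lowers this to [m]. *)
move=> [fin [S [Sfin conv]]]; have [N NP] := conv (\max_i minsize H i).
apply: (@min_height_le_m _ _ _ N) => i [//|h] t; rewrite leqNgt; apply/negP => Nh.
have Yfin n j : is_species (iterate H n j).
  case: n => [|n]; last exact: fin.
  by move=> U; apply/finite_surjP; exists void, id => x; exists x.
apply: (@iterate_iso_no_tree (fun k => k <= \max_i minsize H i) _ _ _ (Yfin h i)
  _ (leq_bigmax i) t).
apply: species_iso_trans (NP _ _ i) (species_iso_sym (NP _ _ i)); lia.
Qed.

Hypothesis Yfin : forall n i, is_species (iterate H n i).

Lemma bounded_well_founded : min_height_bounded H m -> well_founded_system H.
Proof.
move=> bd; split=> [n i|]; first exact: Yfin n.+1 i.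
(* By [height_le], structures of size [k] stop appearing after stage [m * k + m], so the limit takes
   its part of size [k] from there. *)
exists (fun i => glue (fun k => iterate H (m * k + m) i)); split=> [i|p].
  by apply: glue_finite => k; exact: Yfin.
exists (m * p + m) => n le_n i; apply: species_iso_sym; apply: glue_iso => k kp.
apply: iterate_restrict_iso => [|q s le_q /eqP-> t].
  by apply: leq_trans le_n; rewrite leq_add2r leq_mul2l kp orbT.
by have := height_le bd t; lia.
Qed.

Lemma solution_leading_term S i : min_height_bounded H m ->
  combinatorial_solution H S ->
  species_iso (leading_term (S i)) (leading_term (iterate H m i)).
Proof.
move=> bd [_ conv].
have valS : valuation (S i) = valuation (iterate H m i).
  rewrite valuation_iterate //; case: asboolP => [pi|npi]; last first.
    apply: valuation_None => s hs; have [N NP] := conv s.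
    have /iterate_sizeP[h _ t] := proj2 (contact_size (NP N (leqnn _) i) (leqnn s)) hs.
    by apply: npi; exists h, s.
  apply: valuation_Some => [|s hs].
    have [N NP] := conv (minsize H i).
    apply/(contact_size (NP (maxn N m) (leq_maxl _ _) i) (leqnn _)).
    apply/iterate_sizeP; exists (minheight H i); last exact: minheight_tree.
    exact: leq_trans (minheight_le_m pi) (leq_maxr _ _).
  have [N NP] := conv s.
  have /iterate_sizeP[h _] := proj2 (contact_size (NP N (leqnn _) i) (leqnn s)) hs.
  exact: minsize_le.
rewrite /leading_term valS valuation_iterate //.
(* Stage [maxn N m] is late enough both for contact with [S] at the minimal size and for agreement
   with stage [m] at that size. *)
have [N NP] := conv (minsize H i).
apply: species_iso_sym.
apply: species_iso_trans (iterate_restrict_iso (leq_maxr N m) _) _.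
  move=> q s mq; case: asboolP => // _ /eqP[<-] /bd; lia.
apply: restrict_iso_sub (NP (maxn N m) (leq_maxl _ _) i) => s.
by case: asboolP => // _ /eqP[->].
Qed.

End Convergence.

Theorem theorem2p8 (K : Type) (m : nat)
    (H : 'I_m -> prespecies (K + 'I_m)%type)
    (H_species : forall i, is_species (H i))
    (H_iter : forall n, n <= m -> subst_well_defined H (iterate H n)) :
  (well_founded_system H <->
   forall i, species_iso (leading_term (iterate H m i))
                         (leading_term (iterate H m.+1 i))) /\
  (well_founded_system H ->
   forall S, combinatorial_solution H S ->
   forall i, species_iso (leading_term (S i))
                         (leading_term (iterate H m i))).
Proof.
have Yfin := iterate_finite H_species (H_iter m (leqnn m)).
have wfP : well_founded_system H <-> min_height_bounded H m.
  by split; [exact: well_founded_bounded | exact: bounded_well_founded].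
split; first by apply: iff_trans wfP (iff_sym _); exact: leading_term_isoP.
by move=> /wfP bd S solS i; exact: solution_leading_term.
Qed.
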